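(* Let $n=4$ and let $M$ be a $2\times 2$ Griffiths positive matrix of constant coefficient $(1,1)$-forms on $\mathbb{C}^4$ with diagonalized entries. Then $\Omega=\det(M)$ is a Lefschetz form for the bidegrees $(2,0)$, $(1,1)$ and $(0,2)$.
   Context: $V^{p,q}$ is the space of constant coefficient $(p,q)$-forms on $\mathbb{C}^n$. A $(1,1)$-form is Kähler if it equals $\sum_l\frac{\sqrt{-1}}{2}dw_l\wedge d\overline{w_l}$ in some complex linear coordinates. A matrix $M=(\alpha_{i,j})$ of $(1,1)$-forms with $\alpha_{i,j}=\overline{\alpha_{j,i}}$ is Griffiths positive if $\sum_{i,j}\theta_i\alpha_{i,j}\overline{\theta_j}$ is Kähler for every nonzero $\theta$. $M$ has diagonalized entries if in some complex linear coordinates $(z_l)$ every entry is $\sum_l b_{i,j}^{(l)}\frac{\sqrt{-1}}{2}dz_l\wedge d\overline{z_l}$. $\det(M)=\alpha_{1,1}\wedge\alpha_{2,2}-\alpha_{1,2}\wedge\alpha_{2,1}$. $\Omega\in V^{k,k}$ is a Lefschetz form for bidegree $(p,q)$, $p+q=n-k$, if $\alpha\mapsto\alpha\wedge\Omega$ is an isomorphism $V^{p,q}\to V^{n-q,n-p}$. *)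

(* Defs.v *)
From HB Require Import structures.
From mathcomp Require Import all_boot all_order all_algebra.
From mathcomp Require Import reals.
From mathcomp Require Import complex.
Set Implicit Arguments. Unset Strict Implicit. Unset Printing Implicit Defensive.
Import Order.TTheory GRing.Theory Num.Theory.
Local Open Scope ring_scope.

Section Forms.
Variable R : realType.
Variable n : nat.

Definition Cx := R[i].
Definition imC : Cx := Complex 0 1.

(* Real coordinates of the exterior algebra of (C^n)^* (x) C: generators
   dz_0..dz_{n-1} (indices lshift n k) and dzbar_0..dzbar_{n-1}
   (indices rshift n k) of 'I_(n+n).  A constant coefficient ccform is the
   coefficient function on the basis e_S = wedge of the generators in S,
   taken in increasing order. *)
Definition ccform := {ffun {set 'I_(n + n)} -> Cx}.

Definition basis_form (S : {set 'I_(n + n)}) : ccform :=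
  [ffun T => if T == S then 1 else 0].

Definition one_form : ccform := basis_form set0.
Definition dz (k : 'I_n) : ccform := basis_form [set lshift n k].
Definition dzb (k : 'I_n) : ccform := basis_form [set rshift n k].

(* e_S /\ e_T = [S, T disjoint] (-1)^{#{(s,t) in S x T | t < s}} e_{S u T} *)
Definition wsign (S T : {set 'I_(n + n)}) : Cx :=
  (-1) ^+ #|[set p : 'I_(n + n) * 'I_(n + n) |
              [&& p.1 \in S, p.2 \in T & (p.2 < p.1)%N]]|.

Definition wedge (a b : ccform) : ccform :=
  [ffun U => \sum_(S : {set 'I_(n + n)}) \sum_(T : {set 'I_(n + n)})
      if (S :&: T == set0) && (S :|: T == U) then wsign S T * a S * b T
      else 0].

(* complex conjugation of forms: conj(dz_k) = dzbar_k, conj(dzbar_k) = dz_k,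
   extended antilinearly and multiplicatively *)
Definition swap_idx (s : 'I_(n + n)) : 'I_(n + n) :=
  match split s with inl k => rshift n k | inr k => lshift n k end.

Definition conj_form (a : ccform) : ccform :=
  \sum_(S : {set 'I_(n + n)})
     (conjc (a S)) *: \big[wedge/one_form]_(s <- enum S) basis_form [set swap_idx s].

Definition is_pq (p q : nat) (a : ccform) : Prop :=
  forall S : {set 'I_(n + n)}, a S != 0 ->
    #|[set s in S | (s < n)%N]| = p /\ #|[set s in S | (n <= s)%N]| = q.

(* differentials of new linear coordinates w = A z:  dw_l = sum_k A l k dz_k *)
Definition dw (A : 'M[Cx]_n) (l : 'I_n) : ccform := \sum_k A l k *: dz k.
Definition dwb (A : 'M[Cx]_n) (l : 'I_n) : ccform := \sum_k conjc (A l k) *: dzb k.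

Definition std11 (A : 'M[Cx]_n) (l : 'I_n) : ccform :=
  (imC / 2) *: wedge (dw A l) (dwb A l).

Definition kahler (a : ccform) : Prop :=
  exists A : 'M[Cx]_n, A \in unitmx /\ a = \sum_l std11 A l.

Definition is_11_matrix (M : 'I_2 -> 'I_2 -> ccform) : Prop :=
  forall i j, is_pq 1 1 (M i j).

Definition hermitian_matrix (M : 'I_2 -> 'I_2 -> ccform) : Prop :=
  forall i j, M i j = conj_form (M j i).

Definition griffiths_positive (M : 'I_2 -> 'I_2 -> ccform) : Prop :=
  is_11_matrix M /\ hermitian_matrix M /\
  forall theta : 'I_2 -> Cx, (exists i, theta i != 0) ->
    kahler (\sum_i \sum_j (theta i * conjc (theta j)) *: M i j).

Definition diagonalized_entries (M : 'I_2 -> 'I_2 -> ccform) : Prop :=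
  exists A : 'M[Cx]_n, A \in unitmx /\
  exists b : 'I_2 -> 'I_2 -> 'I_n -> Cx,
    forall i j, M i j = \sum_l b i j l *: std11 A l.

Definition det_form (M : 'I_2 -> 'I_2 -> ccform) : ccform :=
  wedge (M 0 0) (M 1 1) - wedge (M 0 1) (M 1 0).

Definition lefschetz_form (p q : nat) (Om : ccform) : Prop :=
  exists k : nat, is_pq k k Om /\ (p + q + k = n)%N /\
  (forall a, is_pq p q a -> is_pq (n - q) (n - p) (wedge a Om)) /\
  (forall a b, is_pq p q a -> is_pq p q b -> wedge a Om = wedge b Om -> a = b) /\
  (forall c, is_pq (n - q) (n - p) c -> exists2 a, is_pq p q a & wedge a Om = c).

End Forms.

(* Main.v *)
Require Import Defs.
From HB Require Import structures.
From mathcomp Require Import all_boot all_order all_algebra.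
From mathcomp Require Import reals.
From mathcomp Require Import complex ring lra zify.

(* A linear change of coordinates extends to an automorphism of the exterior
   algebra, so one may assume [Omega = sum_(l < m) D_lm w_l w_m] with
   [w_l = (i/2) dz_l dzbar_l] and [D_lm] the mixed discriminant of the matrices
   [B_l], [B_m] of [l]-th coefficients.  Griffiths positivity says that each
   [B_l] is positive definite, so [D_lm > 0].  Multiplication by [Omega] sends a
   monomial that is not some [w_i] to a nonzero multiple of a monomial, and on
   the span of the [w_i] it is a symmetric 4 x 4 matrix with zero diagonal,
   with [D_jk] in position [(i, l)] when [{i,j,k,l} = {0,1,2,3}], of determinant
   [a^2 + b^2 + c^2 - 2 (ab + bc + ca)], [a = D_01 D_23], [b = D_02 D_13],
   [c = D_03 D_12].  It is also the determinant of the off-diagonal part of the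
   Gram matrix of the [B_l], which are timelike vectors of the same cone for the
   Lorentzian form [2 det] on 2 x 2 Hermitian matrices; such a matrix is
   invertible.  Injectivity suffices, as source and target have the same
   dimension. *)

Set Implicit Arguments. Unset Strict Implicit. Unset Printing Implicit Defensive.
Import Order.TTheory GRing.Theory Num.Theory.
Local Open Scope ring_scope.

(** * Endomorphisms of a coordinate subspace *)

Section Supported.
Variables (K : fieldType) (I : finType).
Local Notation V := {ffun I -> K^o}.

(** The coordinate subspace cut out by [P] is finite-dimensional, so comparing dimensions shows that
    an injective endomorphism of it is onto. *)
Lemma supported_inj_surj (P : pred I) (f : {linear V -> V}) :
  (forall a : V, (forall i, a i != 0 -> P i) -> forall i, f a i != 0 -> P i) ->
  (forall a : V, (forall i, a i != 0 -> P i) -> f a = 0 -> a = 0) ->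
  forall c : V, (forall i, c i != 0 -> P i) ->
    exists2 a : V, (forall i, a i != 0 -> P i) & f a = c.
Proof.
move=> fP fI c cP.
(* [off] erases the coordinates in [P], so its kernel is the subspace of functions supported in
   [P]. *)
pose off (a : V) : V := [ffun i => if P i then 0 else a i].
have off_lin : linear off.
  move=> k a b; apply/ffunP => i; rewrite !ffunE.
  by case: (P i); rewrite ?scaler0 ?addr0.
pose offL := GRing.isLinear.Build _ _ _ _ off off_lin.
pose offl : {linear V -> V} := HB.pack off offL.
pose U : {vspace V} := lker (linfun offl).
have UP (a : V) : reflect (forall i, a i != 0 -> P i) (a \in U).
  rewrite memv_ker lfunE /=; apply: (iffP eqP) => [/ffunP a0 i | aP].
    by have := a0 i; rewrite !ffunE; case: (P i) => // ->; rewrite eqxx.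
  apply/ffunP => i; rewrite !ffunE; case: ifPn => // nPi.
  by apply/eqP; apply: contraNT nPi => /aP.
have sub : (linfun f @: U <= U)%VS.
  by apply/subvP => _ /memv_imgP[a /UP aU ->]; apply/UP; rewrite lfunE; apply: fP.
have ker0 : (U :&: lker (linfun f) = 0)%VS.
  apply/eqP; rewrite -subv0; apply/subvP => a.
  rewrite memv_cap => /andP[/UP aP]; rewrite memv_ker lfunE memv0 => /eqP fa0.
  by apply/eqP/fI.
have /eqP im : (linfun f @: U == U)%VS.
  by rewrite eqEdim sub (limg_dim_eq ker0) leqnn.
have : c \in (linfun f @: U)%VS by rewrite im; apply/UP.
by case/memv_imgP => a /UP aP ->; exists a; rewrite ?lfunE.
Qed.
End Supported.

(** * Exterior algebra *)

(** Both lists are strictly increasing with the same members, and such a list is unique. *)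
Lemma enum_set_min m (S : {set 'I_m}) t :
  t \in S -> (forall s, s \in S -> (t <= s)%N) -> enum S = t :: enum (S :\ t).
Proof.
move=> tS tmin; pose lt := fun i j : 'I_m => (i < j)%N.
have sorted_enum (T : {set 'I_m}) : sorted lt (enum T).
  have lt_tr : transitive lt by move=> x y z; apply: ltn_trans.
  rewrite [enum _]/(filter _ _) -enumT; apply: (sorted_filter lt_tr).
  by have := iota_ltn_sorted 0 m; rewrite -(val_enum_ord m) sorted_map.
apply: (@irr_sorted_eq _ lt) => //.
- by move=> x y z; apply: ltn_trans.
- by move=> x; apply: ltnn.
- rewrite /= path_min_sorted //; apply/allP => s; rewrite mem_enum !inE.
  by case/andP => st /tmin ts; rewrite /lt ltn_neqAle ts andbT eq_sym.
- by move=> s; rewrite inE !mem_enum !inE; case: eqVneq => [->|].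
Qed.

Lemma set_ord_min m (S : {set 'I_m}) : S != set0 ->
  exists2 t, t \in S & forall s, s \in S -> (t <= s)%N.
Proof.
case/set0Pn => i iS; case: (@arg_minnP _ i (mem S) val iS) => t tS tmin.
by exists t.
Qed.

(** Adding a new least index matches products taken along [enum]: each step multiplies by one
    generator on the left. *)
Lemma set_ord_ind m (Q : {set 'I_m} -> Prop) :
  Q set0 ->
  (forall t (S : {set 'I_m}), t \notin S -> (forall s, s \in S -> (t < s)%N) ->
     Q S -> Q (t |: S)) ->
  forall S, Q S.
Proof.
move=> Q0 QS S; have [k] := ubnP #|S|; elim: k S => // k IH S Sk.
have [->//|/set_ord_min[t tS tmin]] := eqVneq S set0.
rewrite -(setD1K tS); apply: QS; first by rewrite !inE eqxx.
  move=> s; rewrite !inE => /andP[st /tmin ts].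
  by rewrite ltn_neqAle ts andbT eq_sym.
by apply: IH; move: Sk; rewrite (cardsD1 t) tS.
Qed.

Section Exterior.
Variables (R : realType) (n : nat).
Local Notation form := (ccform R n).
Local Notation C := (Cx R).
Local Notation idx := 'I_(n + n).
Implicit Types (a b c : form) (S T U : {set idx}).

Local Notation e := (@basis_form R n).
Local Notation e1 s := (e [set s]).
Local Notation sgn := (@wsign R n).

(** In product form the sign is visibly multiplicative over disjoint unions in each argument, which
    is the source of associativity. *)
Lemma wsignE S T : sgn S T = \prod_(s in S) \prod_(t in T) (-1) ^+ (t < s)%N.
Proof.
rewrite /wsign -sum1_card -prodrXr pair_big /= (big_mkcond (fun p => p \in _)).
rewrite [RHS]big_mkcond; apply: eq_bigr => -[s t] _; rewrite inE /=.
by case: (s \in S); case: (t \in T); case: (t < s)%N.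
Qed.

Lemma wsignUl S T U : [disjoint S & T] -> sgn (S :|: T) U = sgn S U * sgn T U.
Proof. by move=> ST; rewrite !wsignE -bigU // ; apply: eq_bigl => s; rewrite !inE. Qed.

Lemma wsignUr S T U : [disjoint T & U] -> sgn S (T :|: U) = sgn S T * sgn S U.
Proof.
move=> TU; rewrite !wsignE -big_split; apply: eq_bigr => s _.
by rewrite -bigU //; apply: eq_bigl => t; rewrite !inE.
Qed.

Lemma wsign11 s t : sgn [set s] [set t] = (-1) ^+ (t < s)%N.
Proof. by rewrite wsignE !big_set1. Qed.

Lemma wsign_set0l S : sgn set0 S = 1.
Proof. by rewrite wsignE big_set0. Qed.

Lemma wsign_set0r S : sgn S set0 = 1.
Proof. by rewrite wsignE big1 // => s _; rewrite big_set0. Qed.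

Lemma wsign_min (t : idx) S : (forall s, s \in S -> (t < s)%N) -> sgn [set t] S = 1.
Proof.
move=> tS; rewrite wsignE big_set1 big1 // => s /tS ts.
by rewrite ltnNge (ltnW ts).
Qed.

Lemma formZE k a S : (k *: a) S = k * a S.
Proof. by rewrite ffunE. Qed.

Definition basis_wedge S T : form :=
  if S :&: T == set0 then sgn S T *: e (S :|: T) else 0.

Lemma wedge_coord a b :
  wedge a b = \sum_S \sum_T (a S * b T) *: basis_wedge S T.
Proof.
apply/ffunP => U; rewrite ffunE sum_ffunE; apply: eq_bigr => S _.
rewrite sum_ffunE; apply: eq_bigr => T _; rewrite /basis_wedge.
rewrite formZE; case: (S :&: T == set0) => /=; last by rewrite ffunE mulr0.
rewrite formZE ffunE eq_sym; case: (U == S :|: T); rewrite ?mulr0 // mulr1.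
by rewrite [RHS]mulrC mulrA.
Qed.

Lemma form_coord a : a = \sum_S a S *: e S.
Proof.
apply/ffunP => U; rewrite sum_ffunE (bigD1 U) //= big1 ?addr0.
  by rewrite formZE ffunE eqxx mulr1.
by move=> S SU; rewrite formZE ffunE eq_sym (negbTE SU) mulr0.
Qed.

Lemma wedge_linearr a : linear (wedge a).
Proof.
move=> k b c; rewrite !wedge_coord scaler_sumr -big_split; apply: eq_bigr => S _.
rewrite scaler_sumr -big_split; apply: eq_bigr => T _ /=.
by rewrite scalerA -scalerDl ffunE formZE; congr (_ *: _); ring.
Qed.

Lemma wedge_linearl b : linear (@wedge R n ^~ b).
Proof.
move=> k a c; rewrite !wedge_coord scaler_sumr -big_split; apply: eq_bigr => S _.
rewrite scaler_sumr -big_split; apply: eq_bigr => T _ /=.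
by rewrite scalerA -scalerDl ffunE formZE; congr (_ *: _); ring.
Qed.

(** The swapped arguments let linearity in the left factor be registered as an instance. *)
Definition wedger b a : form := wedge a b.

HB.instance Definition _ a :=
  GRing.isLinear.Build C form form *:%R (wedge a) (wedge_linearr a).
HB.instance Definition _ b :=
  GRing.isLinear.Build C form form *:%R (wedger b) (wedge_linearl b).

Lemma wedge0r a : wedge a 0 = 0. Proof. exact: linear0. Qed.
Lemma wedge0l a : wedge 0 a = 0. Proof. exact: (linear0 (wedger a)). Qed.
Lemma wedgeDl a b c : wedge (a + b) c = wedge a c + wedge b c.
Proof. exact: (linearD (wedger c)). Qed.
Lemma wedgeNl a b : wedge (- a) b = - wedge a b.
Proof. exact: (linearN (wedger b)). Qed.
Lemma wedgeBl a b c : wedge (a - b) c = wedge a c - wedge b c.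
Proof. exact: (linearB (wedger c)). Qed.
Lemma wedgeZr k a b : wedge a (k *: b) = k *: wedge a b.
Proof. exact: linearZ. Qed.
Lemma wedgeZl k a b : wedge (k *: a) b = k *: wedge a b.
Proof. exact: (linearZ_LR (wedger b)). Qed.
Lemma wedge_sumr I (r : seq I) (P : pred I) (F : I -> form) a :
  wedge a (\sum_(i <- r | P i) F i) = \sum_(i <- r | P i) wedge a (F i).
Proof. exact: linear_sum. Qed.
Lemma wedge_suml I (r : seq I) (P : pred I) (F : I -> form) a :
  wedge (\sum_(i <- r | P i) F i) a = \sum_(i <- r | P i) wedge (F i) a.
Proof. exact: (linear_sum (wedger a)). Qed.

Lemma wedge_basis S T : wedge (e S) (e T) = basis_wedge S T.
Proof.
rewrite wedge_coord (bigD1 S) //= [X in _ + X]big1 => [|U neU]; last first.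
  by apply: big1 => V _; rewrite ffunE (negbTE neU) mul0r scale0r.
rewrite addr0 (bigD1 T) //= big1 => [|U neU].
  by rewrite !ffunE !eqxx mulr1 scale1r addr0.
by rewrite [in X in _ * X]ffunE (negbTE neU) mulr0 scale0r.
Qed.

Lemma wedge_basis_disjoint S T : S :&: T = set0 ->
  wedge (e S) (e T) = sgn S T *: e (S :|: T).
Proof. by rewrite wedge_basis /basis_wedge => ->; rewrite eqxx. Qed.

Lemma wedge_basis_meet S T : S :&: T != set0 -> wedge (e S) (e T) = 0.
Proof. by rewrite wedge_basis /basis_wedge => /negbTE->. Qed.

Lemma wedge1l a : wedge (@one_form R n) a = a.
Proof.
rewrite [in RHS](form_coord a) [in LHS](form_coord a) wedge_sumr.
apply: eq_bigr => S _.
by rewrite wedgeZr (wedge_basis_disjoint (set0I S)) wsign_set0l set0U scale1r.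
Qed.

Lemma wedge1r a : wedge a (@one_form R n) = a.
Proof.
rewrite [in RHS](form_coord a) [in LHS](form_coord a) wedge_suml.
apply: eq_bigr => S _.
by rewrite wedgeZl (wedge_basis_disjoint (setI0 S)) wsign_set0r setU0 scale1r.
Qed.

(** If two of the sets meet, both sides vanish; otherwise both carry the product of the three
    pairwise signs. *)
Lemma wedge_basisA S T U :
  wedge (e S) (wedge (e T) (e U)) = wedge (wedge (e S) (e T)) (e U).
Proof.
have [ST|ST] := eqVneq (S :&: T) set0; last first.
  rewrite (wedge_basis_meet ST) wedge0l.
  have [TU|TU] := eqVneq (T :&: U) set0; last by rewrite (wedge_basis_meet TU) wedge0r.
  rewrite wedge_basis_disjoint // wedgeZr wedge_basis_meet ?scaler0 //.
  by apply: contraNneq ST; rewrite setIUr => /eqP; rewrite setU_eq0 => /andP[].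
have [TU|TU] := eqVneq (T :&: U) set0; last first.
  rewrite (wedge_basis_meet TU) wedge0r wedge_basis_disjoint // wedgeZl.
  rewrite wedge_basis_meet ?scaler0 //.
  by apply: contraNneq TU; rewrite setIUl => /eqP; rewrite setU_eq0 => /andP[].
rewrite (wedge_basis_disjoint ST) (wedge_basis_disjoint TU) wedgeZl wedgeZr.
have [SU|SU] := eqVneq (S :&: U) set0; last first.
  rewrite !wedge_basis_meet ?scaler0 //.
    by apply: contraNneq SU; rewrite setIUl => /eqP; rewrite setU_eq0 => /andP[].
  by apply: contraNneq SU; rewrite setIUr => /eqP; rewrite setU_eq0 => /andP[].
have STU : S :&: (T :|: U) = set0 by rewrite setIUr ST SU setU0.
have STU' : (S :|: T) :&: U = set0 by rewrite setIUl SU TU setU0.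
rewrite (wedge_basis_disjoint STU) (wedge_basis_disjoint STU') !scalerA setUA.
have dTU : [disjoint T & U] by rewrite -setI_eq0 TU.
have dST : [disjoint S & T] by rewrite -setI_eq0 ST.
by rewrite (wsignUl _ dST) (wsignUr _ dTU) [in LHS]mulrC mulrA.
Qed.

Lemma wedgeA a b c : wedge a (wedge b c) = wedge (wedge a b) c.
Proof.
rewrite [a]form_coord !wedge_suml; apply: eq_bigr => S _; rewrite !wedgeZl.
congr (_ *: _); rewrite [b]form_coord wedge_suml !wedge_sumr wedge_suml.
apply: eq_bigr => T _; rewrite !wedgeZl !wedgeZr wedgeZl; congr (_ *: _).
rewrite [c]form_coord !wedge_sumr; apply: eq_bigr => U _; rewrite !wedgeZr.
by rewrite wedge_basisA.
Qed.

End Exterior.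

(** * Algebra endomorphisms of the exterior algebra *)

Section Substitution.
Variables (R : realType) (n : nat).
Local Notation form := (ccform R n).
Local Notation C := (Cx R).
Local Notation idx := 'I_(n + n).
Implicit Types (a b c : form) (S T U : {set idx}).
Local Notation e := (@basis_form R n).
Local Notation e1 s := (e [set s]).

Lemma basis_form_min t S : t \notin S -> (forall s, s \in S -> (t < s)%N) ->
  e (t |: S) = wedge (e1 t) (e S).
Proof.
move=> tS tmin; rewrite wedge_basis_disjoint ?wsign_min ?scale1r //.
by apply/eqP; rewrite setI_eq0 disjoints1.
Qed.

Lemma wedge_basis1C s t : wedge (e1 s) (e1 t) = - wedge (e1 t) (e1 s).
Proof.
have [<-|st] := eqVneq s t.
  by rewrite wedge_basis_meet ?oppr0 // setIid -cards_eq0 cards1.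
rewrite !wedge_basis_disjoint ?wsign11; last 2 first.
- by apply/eqP; rewrite setI_eq0 disjoints1 inE eq_sym.
- by apply/eqP; rewrite setI_eq0 disjoints1 inE.
rewrite setUC -scaleNr; congr (_ *: _).
by move: st; rewrite -val_eqE /=; case: ltngtP => //= _ _; rewrite ?opprK.
Qed.

Variable x : idx -> form.
Hypothesis xC : forall s t, wedge (x s) (x t) = - wedge (x t) (x s).

(** Anticommutation makes twice the square vanish, and 2 is invertible in [C]. *)
Lemma anticommuting_square0 s : wedge (x s) (x s) = 0.
Proof.
have xx : wedge (x s) (x s) *+ 2 = 0 by rewrite mulr2n {1}xC addNr.
by rewrite -[LHS]scale1r -(@mulVf C 2%:R) ?pnatr_eq0 // -scalerA scaler_nat xx scaler0.
Qed.

Definition monomial S : form := \big[@wedge R n/@one_form R n]_(s <- enum S) x s.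

Definition subst_form a : form := \sum_S a S *: monomial S.

Lemma monomial_min t S : t \notin S -> (forall s, s \in S -> (t < s)%N) ->
  monomial (t |: S) = wedge (x t) (monomial S).
Proof.
move=> tS tmin; rewrite /monomial (@enum_set_min _ _ t) ?setU11 //.
  by rewrite big_cons setU1K.
by move=> s; rewrite !inE => /orP[/eqP->//|/tmin/ltnW].
Qed.

Lemma subst_form_linear : linear subst_form.
Proof.
move=> k a b; rewrite /subst_form scaler_sumr -big_split; apply: eq_bigr => S _.
by rewrite ffunE formZE scalerDl scalerA.
Qed.

HB.instance Definition _ :=
  GRing.isLinear.Build C form form *:%R subst_form subst_form_linear.

Lemma subst_basis S : subst_form (e S) = monomial S.
Proof.
rewrite /subst_form (bigD1 S) //= big1 ?addr0 ?ffunE ?eqxx ?scale1r //.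
by move=> T TS; rewrite ffunE (negbTE TS) scale0r.
Qed.

Lemma monomial0 : monomial set0 = @one_form R n.
Proof. by rewrite /monomial enum_set0 big_nil. Qed.

Lemma monomial1 s : monomial [set s] = x s.
Proof. by rewrite /monomial enum_set1 big_seq1_id wedge1r. Qed.

(** Sorted insertion of [s] into [t |: T], with [t] least: nothing moves if [s < t], and both sides
    vanish if [s = t]. *)
Lemma wedge_gen_monomial s T :
  wedge (x s) (monomial T) = subst_form (wedge (e1 s) (e T)).
Proof.
elim/set_ord_ind: T s => [|t T tT tmin IH] s.
  by rewrite monomial0 !wedge1r subst_basis monomial1.
rewrite monomial_min // basis_form_min //.
have [st|ts|/ord_inj->] := ltngtP s t.
- have sT : s \notin t |: T.
    apply/negP; rewrite !inE => /orP[/eqP est|/tmin]; first by rewrite est ltnn in st.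
    by rewrite ltnNge (ltnW st).
  have smin r : r \in t |: T -> (s < r)%N.
    by rewrite !inE => /orP[/eqP->//|/tmin]; apply: ltn_trans.
  by rewrite -basis_form_min // -basis_form_min // subst_basis -!monomial_min.
(* When [t < s], moving the generator [s] past [t] costs the same sign on both sides, and the
   induction hypothesis inserts [s] into [T]. *)
- rewrite !wedgeA xC (wedge_basis1C s t) !wedgeNl linearN /= -!wedgeA IH.
  congr (- _).
  have [sT|sT] := boolP (s \in T).
    have meet : [set s] :&: T != set0 by apply/set0Pn; exists s; rewrite !inE eqxx.
    by rewrite (wedge_basis_meet _ meet) !linear0.
  have disj : [set s] :&: T = set0 by apply/eqP; rewrite setI_eq0 disjoints1.
  rewrite (wedge_basis_disjoint _ disj).
  rewrite !linearZ /=; congr (_ *: _).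
  have tsT : t \notin s |: T by rewrite !inE negb_or tT -val_eqE /= neq_ltn ts.
  have smin r : r \in s |: T -> (t < r)%N by rewrite !inE => /orP[/eqP->//|/tmin].
  by rewrite subst_basis -basis_form_min // subst_basis -monomial_min.
- rewrite !wedgeA anticommuting_square0 wedge0l wedge_basis_meet ?wedge0l ?linear0 //.
  by rewrite setIid -cards_eq0 cards1.
Qed.

(** Universal property of the exterior algebra: by linearity [a] may be a monomial, which is built
    up one generator at a time. *)
Lemma subst_wedge a b : subst_form (wedge a b) = wedge (subst_form a) (subst_form b).
Proof.
have gen s c : subst_form (wedge (e1 s) c) = wedge (x s) (subst_form c).
  rewrite {1}[c]form_coord wedge_sumr linear_sum /= [in RHS]/subst_form wedge_sumr.
  by apply: eq_bigr => T _; rewrite !wedgeZr !linearZ /= wedge_gen_monomial.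
have mon S c : subst_form (wedge (e S) c) = wedge (monomial S) (subst_form c).
  elim/set_ord_ind: S => [|t S tS tmin IH]; first by rewrite wedge1l monomial0 wedge1l.
  by rewrite basis_form_min // monomial_min // -!wedgeA gen IH.
rewrite {1}[a]form_coord wedge_suml linear_sum /= {2}/subst_form wedge_suml.
by apply: eq_bigr => S _; rewrite !wedgeZl linearZ /= mon.
Qed.

End Substitution.

(** * Behaviour of bidegrees under sums, products and substitutions *)

Section Bidegree.
Variables (R : realType) (n : nat).
Local Notation form := (ccform R n).
Local Notation idx := 'I_(n + n).
Implicit Types (a b c : form) (S T U : {set idx}) (p q : nat).
Local Notation e := (@basis_form R n).

Lemma is_pq0 p q : is_pq p q (0 : form).
Proof. by move=> S; rewrite ffunE eqxx. Qed.

Lemma is_pqD p q a b : is_pq p q a -> is_pq p q b -> is_pq p q (a + b).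
Proof.
move=> pa pb S; rewrite ffunE; have [aS0|/pa//] := eqVneq (a S) 0.
by rewrite aS0 add0r => /pb.
Qed.

Lemma is_pqZ p q k a : is_pq p q a -> is_pq p q (k *: a).
Proof. by move=> pa S; rewrite ffunE mulf_eq0 negb_or => /andP[_ /pa]. Qed.

Lemma is_pqB p q a b : is_pq p q a -> is_pq p q b -> is_pq p q (a - b).
Proof. by move=> pa pb; rewrite -scaleN1r; apply/is_pqD/is_pqZ. Qed.

Lemma is_pq_sum p q I (r : seq I) (P : pred I) (F : I -> form) :
  (forall i, P i -> is_pq p q (F i)) -> is_pq p q (\sum_(i <- r | P i) F i).
Proof.
by move=> PF; elim/big_rec: _ => [|i a Pi pa]; [exact: is_pq0|apply: is_pqD; first exact: PF].
Qed.

Lemma is_pq_basis S : is_pq #|[set s in S | (s < n)%N]| #|[set s in S | (n <= s)%N]| (e S).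
Proof. by move=> T; rewrite ffunE; case: (eqVneq T S) => [->|]; rewrite ?eqxx. Qed.

Lemma is_pq_wedge p q p' q' a b :
  is_pq p q a -> is_pq p' q' b -> is_pq (p + p') (q + q') (wedge a b).
Proof.
move=> pa pb; rewrite wedge_coord; apply: is_pq_sum => S _; apply: is_pq_sum => T _.
have [aS|/pa[Sp Sq]] := eqVneq (a S) 0; first by rewrite aS mul0r scale0r; apply: is_pq0.
have [bT|/pb[Tp Tq]] := eqVneq (b T) 0; first by rewrite bT mulr0 scale0r; apply: is_pq0.
apply: is_pqZ; rewrite /basis_wedge; case: eqP => [ST|_]; last exact: is_pq0.
apply: is_pqZ => U; rewrite ffunE; case: (U =P _) => [->|]; last by rewrite eqxx.
have card (r : pred idx) :
  #|[set s in S :|: T | r s]| = (#|[set s in S | r s]| + #|[set s in T | r s]|)%N.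
  rewrite !setIdE setIUl cardsU -setIIl ST set0I cards0 subn0 //.
by move=> _; rewrite !card Sp Sq Tp Tq.
Qed.

Lemma is_pq_subst x p q a :
  (forall k, is_pq 1 0 (x (lshift n k))) -> (forall k, is_pq 0 1 (x (rshift n k))) ->
  is_pq p q a -> is_pq p q (subst_form x a).
Proof.
move=> xl xr pa; apply: is_pq_sum => S _.
have [aS|/pa[<- <-]] := eqVneq (a S) 0; first by rewrite aS scale0r; apply: is_pq0.
apply: is_pqZ; elim/set_ord_ind: S => [|t S tS tmin IH].
  have no (r : pred idx) : [set s in set0 | r s] = set0.
    by apply/setP => s; rewrite !inE.
  by rewrite monomial0 !no cards0; have := @is_pq_basis set0; rewrite !no cards0.
rewrite monomial_min //.
have card (r : pred idx) : #|[set s in t |: S | r s]| = (r t + #|[set s in S | r s]|)%N.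
  rewrite (cardsD1 t) !inE eqxx /=; congr (_ + _)%N; apply: eq_card => s.
  rewrite !inE; case: eqVneq => //= ->; by rewrite (negbTE tS).
rewrite !card; apply: is_pq_wedge => //.
case: (split_ordP t) => k -> /=.
  by rewrite leqNgt ltn_ord; apply: xl.
by rewrite leq_addr; apply: xr.
Qed.
End Bidegree.

(** * Linear changes of coordinates *)

Section Coordinates.
Variables (R : realType) (n : nat).
Local Notation form := (ccform R n).
Local Notation C := (Cx R).
Local Notation idx := 'I_(n + n).
Implicit Types (a b c : form) (S T U : {set idx}) (A B : 'M[C]_n).
Local Notation e := (@basis_form R n).
Local Notation e1 s := (e [set s]).

Lemma wedge_one_formsC (u v : idx -> C) :
  wedge (\sum_s u s *: e1 s) (\sum_s v s *: e1 s) =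
  - wedge (\sum_s v s *: e1 s) (\sum_s u s *: e1 s).
Proof.
rewrite !wedge_suml -sumrN.
under eq_bigr do rewrite wedge_sumr.
under [RHS]eq_bigr do rewrite wedge_sumr -sumrN.
rewrite exchange_big; apply: eq_bigr => s _; apply: eq_bigr => t _ /=.
by rewrite !wedgeZl !wedgeZr (wedge_basis1C R t s) !scalerN !scalerA mulrC.
Qed.

Definition coframe A (s : idx) : form :=
  match split s with inl l => dw A l | inr l => dwb A l end.

Lemma coframe_lshift A l : coframe A (lshift n l) = dw A l.
Proof. by rewrite /coframe (unsplitK (inl l)). Qed.

Lemma coframe_rshift A l : coframe A (rshift n l) = dwb A l.
Proof. by rewrite /coframe (unsplitK (inr l)). Qed.

Lemma coframe_one_form A s : exists u : idx -> C, coframe A s = \sum_t u t *: e1 t.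
Proof.
rewrite /coframe; case: (split s) => l.
  exists (fun t => if split t is inl k then A l k else 0).
  rewrite big_split_ord /= [X in _ = _ + X]big1 ?addr0 => [|k _]; last first.
    by rewrite (unsplitK (inr k)) scale0r.
  by apply: eq_bigr => k _; rewrite (unsplitK (inl k)).
exists (fun t => if split t is inr k then conjc (A l k) else 0).
rewrite big_split_ord /= big1 ?add0r => [|k _]; last first.
  by rewrite (unsplitK (inl k)) scale0r.
by apply: eq_bigr => k _; rewrite (unsplitK (inr k)).
Qed.

Lemma coframeC A s t :
  wedge (coframe A s) (coframe A t) = - wedge (coframe A t) (coframe A s).
Proof.
have [[u ->] [v ->]] := (coframe_one_form A s, coframe_one_form A t).
exact: wedge_one_formsC.
Qed.

(** The algebra endomorphism extending the change of coordinates [w = A z]; it is an automorphism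
    when [A] is invertible. *)
Definition pullback A : form -> form := subst_form (coframe A).

HB.instance Definition _ A := GRing.Linear.on (pullback A).

Lemma pullback_wedge A a b :
  pullback A (wedge a b) = wedge (pullback A a) (pullback A b).
Proof. exact/subst_wedge/coframeC. Qed.

Lemma pullback_dz A l : pullback A (@dz R n l) = dw A l.
Proof. by rewrite /pullback subst_basis monomial1 coframe_lshift. Qed.

Lemma pullback_dzb A l : pullback A (@dzb R n l) = dwb A l.
Proof. by rewrite /pullback subst_basis monomial1 coframe_rshift. Qed.

Lemma pullback_one A : pullback A (one_form R n) = one_form R n.
Proof. by rewrite /pullback subst_basis monomial0. Qed.

(** Substituting [A z] for [z] in [B z] gives [B A z], hence the order of the matrix product. *)
Lemma pullback_dw A B l : pullback A (dw B l) = dw (B *m A) l.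
Proof.
rewrite /dw linear_sum; under eq_bigr do rewrite linearZ /= pullback_dz scaler_sumr.
rewrite exchange_big; apply: eq_bigr => k _ /=.
by rewrite mxE scaler_suml; apply: eq_bigr => j _; rewrite scalerA.
Qed.

Lemma pullback_dwb A B l : pullback A (dwb B l) = dwb (B *m A) l.
Proof.
rewrite /dwb linear_sum; under eq_bigr do rewrite linearZ /= pullback_dzb scaler_sumr.
rewrite exchange_big; apply: eq_bigr => k _ /=.
rewrite mxE rmorph_sum scaler_suml; apply: eq_bigr => j _.
by rewrite scalerA rmorphM.
Qed.

Lemma dw1 l : dw 1%:M l = @dz R n l.
Proof.
rewrite /dw (bigD1 l) //= mxE eqxx scale1r big1 ?addr0 // => k kl.
by rewrite mxE eq_sym (negbTE kl) scale0r.
Qed.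

Lemma dwb1 l : dwb 1%:M l = @dzb R n l.
Proof.
rewrite /dwb (bigD1 l) //= mxE eqxx conjc1 scale1r big1 ?addr0 // => k kl.
by rewrite mxE eq_sym (negbTE kl) conjc0 scale0r.
Qed.

(** Pullbacks are multiplicative, so it suffices that every generator returns to itself. *)
Lemma pullbackK A B : B *m A = 1%:M -> cancel (pullback B) (pullback A).
Proof.
move=> BA a; rewrite [in RHS](form_coord a) /(pullback B) /subst_form linear_sum.
apply: eq_bigr => S _; rewrite linearZ /=; congr (_ *: _).
elim/set_ord_ind: S => [|t S tS tmin IH]; first by rewrite monomial0 pullback_one.
rewrite monomial_min // basis_form_min // pullback_wedge IH; congr (wedge _ _).
case: (split_ordP t) => l ->.
  by rewrite coframe_lshift pullback_dw BA dw1.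
by rewrite coframe_rshift pullback_dwb BA dwb1.
Qed.

Lemma is_pq_dz l : is_pq 1 0 (@dz R n l).
Proof.
move=> S; rewrite ffunE; case: (S =P _) => [->|]; last by rewrite eqxx.
move=> _; split; first (apply/eqP/cards1P; exists (lshift n l)).
  by apply/setP => s; rewrite !inE; case: eqP => [->|]; rewrite //= ltn_ord.
apply: eq_card0 => s; rewrite !inE; case: eqP => [->|]; rewrite //=.
by rewrite leqNgt ltn_ord.
Qed.

Lemma is_pq_dzb l : is_pq 0 1 (@dzb R n l).
Proof.
move=> S; rewrite ffunE; case: (S =P _) => [->|]; last by rewrite eqxx.
move=> _; split; last (apply/eqP/cards1P; exists (rshift n l)).
  apply: eq_card0 => s; rewrite !inE; case: eqP => [->|]; rewrite //=.
  by rewrite ltnNge leq_addr.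
by apply/setP => s; rewrite !inE; case: eqP => [->|]; rewrite //= leq_addr.
Qed.

Lemma is_pq_pullback A p q a : is_pq p q a -> is_pq p q (pullback A a).
Proof.
apply: is_pq_subst => k.
  by rewrite coframe_lshift; apply: is_pq_sum => l _; apply/is_pqZ/is_pq_dz.
by rewrite coframe_rshift; apply: is_pq_sum => l _; apply/is_pqZ/is_pq_dzb.
Qed.

(** Pulling back by [invmx A] turns the equation for [pullback A Om] into one for [Om] and keeps the
    bidegree. *)
Lemma wedge_pullback_inj p q A Om : A \in unitmx ->
  (forall a, is_pq p q a -> wedge a Om = 0 -> a = 0) ->
  forall a, is_pq p q a -> wedge a (pullback A Om) = 0 -> a = 0.
Proof.
move=> uA Om_inj a pa; rewrite -(pullbackK (mulVmx uA) a) -pullback_wedge.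
move=> /(congr1 (pullback (invmx A))); rewrite (pullbackK (mulmxV uA)) linear0.
by move/Om_inj => -> //; [rewrite linear0|apply: is_pq_pullback].
Qed.

(** * Comparison of the bidegrees [(p,q)] and [(n-q,n-p)] *)

Lemma card_holomorphic S :
  #|[set s in S | (s < n)%N]| = #|[set k : 'I_n | lshift n k \in S]|.
Proof.
rewrite -!sum1_card [LHS]big_mkcond [RHS]big_mkcond big_split_ord /= [X in (_ + X)%N]big1 ?addn0.
  by apply: eq_bigr => k _; rewrite !inE /= ltn_ord andbT.
by move=> k _; rewrite inE /= ltnNge leq_addr andbF.
Qed.

Lemma card_antiholomorphic S :
  #|[set s in S | (n <= s)%N]| = #|[set k : 'I_n | rshift n k \in S]|.
Proof.
rewrite -!sum1_card [LHS]big_mkcond [RHS]big_mkcond big_split_ord /= [X in (X + _)%N]big1 ?add0n.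
  by apply: eq_bigr => k _; rewrite !inE /= leq_addr andbT.
by move=> k _; rewrite inE /= leqNgt ltn_ord andbF.
Qed.

(** Complementation combined with the exchange of [dz_k] and [dzbar_k]: it matches the basis in
    bidegree [(p,q)] with the one in bidegree [(n-q,n-p)]. *)
Definition flip S : {set idx} := [set s | swap_idx s \notin S].

Lemma swap_idx_lshift k : swap_idx (lshift n k) = rshift n k.
Proof. by rewrite /swap_idx (unsplitK (inl k)). Qed.

Lemma swap_idx_rshift k : swap_idx (rshift n k) = lshift n k.
Proof. by rewrite /swap_idx (unsplitK (inr k)). Qed.

Lemma flipK : involutive flip.
Proof.
move=> S; apply/setP => s; rewrite !inE negbK; case: (split_ordP s) => k ->.
  by rewrite swap_idx_lshift swap_idx_rshift.
by rewrite swap_idx_rshift swap_idx_lshift.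
Qed.

Lemma card_flip S :
  #|[set s in flip S | (s < n)%N]| = (n - #|[set s in S | (n <= s)%N]|)%N /\
  #|[set s in flip S | (n <= s)%N]| = (n - #|[set s in S | (s < n)%N]|)%N.
Proof.
rewrite !card_holomorphic !card_antiholomorphic.
have cardB (Q : pred 'I_n) : #|[set k | ~~ Q k]| = (n - #|[set k | Q k]|)%N.
  rewrite -[X in (X - _)%N](card_ord n) -(cardsC [set k | Q k]) addKn; apply: eq_card => k.
  by rewrite !inE.
split; rewrite -cardB; apply: eq_card => k.
  by rewrite !inE swap_idx_lshift.
by rewrite !inE swap_idx_rshift.
Qed.

(** Reindexing the target by [flip] turns the product with [Om] into an endomorphism of the forms of
    bidegree [(p,q)], where injectivity gives surjectivity. *)
Lemma lefschetz_form_of_inj p q k (Om : form) :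
  is_pq k k Om -> (p + q + k = n)%N ->
  (forall a, is_pq p q a -> wedge a Om = 0 -> a = 0) -> lefschetz_form p q Om.
Proof.
move=> pOm pqk inj; exists k; split=> //; split=> //.
have pk : (p + k = n - q)%N by lia.
have qk : (q + k = n - p)%N by lia.
have map_pq a : is_pq p q a -> is_pq (n - q) (n - p) (wedge a Om).
  by move=> pa; rewrite -pk -qk; apply: is_pq_wedge.
split=> //; split=> [a b pa pb /eqP|c pc].
  rewrite -subr_eq0 -wedgeBl => /eqP/inj ab.
  by apply/eqP; rewrite -subr_eq0 ab //; apply: is_pqB.
pose f (a : {ffun {set idx} -> C^o}) : {ffun {set idx} -> C^o} :=
  [ffun S => wedge (a : form) Om (flip S)].
have fE a S : f a S = wedge (a : form) Om (flip S) by rewrite ffunE.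
have f_lin : linear f.
  move=> t a b; apply/ffunP => S.
  have E : wedge (t *: (a : form) + (b : form)) Om =
      t *: wedge (a : form) Om + wedge (b : form) Om.
    by rewrite wedgeDl wedgeZl.
  rewrite fE [LHS](congr1 (fun g : form => g (flip S)) E).
  rewrite -[RHS]/((t *: (f a : form) + (f b : form)) S).
  by rewrite [LHS]ffunE [RHS]ffunE !formZE !fE.
pose fL := GRing.isLinear.Build _ _ _ _ f f_lin.
pose fl : {linear {ffun {set idx} -> C^o} -> {ffun {set idx} -> C^o}} := HB.pack f fL.
pose P S := (#|[set s in S | (s < n)%N]| == p) && (#|[set s in S | (n <= s)%N]| == q).
have is_pqP a : (forall S, a S != 0 -> P S) <-> is_pq p q a.
  split=> pa S /pa; first by case/andP => /eqP-> /eqP->.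
  by case=> Sp Sq; rewrite /P Sp Sq !eqxx.
have P_flip S : (P (flip S)) =
    (#|[set s in S | (s < n)%N]| == (n - q)%N) && (#|[set s in S | (n <= s)%N]| == (n - p)%N).
  (* Subtraction is truncated, so these bounds are needed to recover a cardinal from its difference
     with [n]. *)
  have le_lo : (#|[set s in S | (s < n)%N]| <= n)%N.
    by rewrite card_holomorphic -[X in (_ <= X)%N](card_ord n) max_card.
  have le_hi : (#|[set s in S | (n <= s)%N]| <= n)%N.
    by rewrite card_antiholomorphic -[X in (_ <= X)%N](card_ord n) max_card.
  rewrite /P !(card_flip S).1 !(card_flip S).2.
  by apply/andP/andP => -[/eqP ? /eqP ?]; split; apply/eqP; lia.
have [|||b Pb fb] := @supported_inj_surj C {set idx} P fl _ _ [ffun S => (c (flip S) : C^o)].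
- move=> a Pa S; rewrite /= fE => /map_pq[]; first exact/is_pqP.
  by move=> lo hi; rewrite -(flipK S) P_flip lo hi !eqxx.
- move=> a Pa fa; apply: inj; first exact/is_pqP.
  apply/ffunP => S; have /ffunP/(_ (flip S)) := fa.
  by rewrite /= fE flipK !ffunE.
- move=> S; rewrite ffunE => /pc[lo hi].
  by rewrite -(flipK S) P_flip lo hi !eqxx.
exists (b : form); first exact/is_pqP.
apply/ffunP => S; have /ffunP/(_ (flip S)) := fb.
by rewrite /= fE flipK => ->; rewrite ffunE flipK.
Qed.
End Coordinates.

(** * Lorentzian geometry of 2 x 2 Hermitian matrices *)

Lemma ord4_cases (i : 'I_4) : [\/ i = 0, i = 1, i = 2 | i = 3].
Proof.
by case: i => -[|[|[|[|//]]]] lti;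
  [apply: Or41|apply: Or42|apply: Or43|apply: Or44]; apply: val_inj.
Qed.

Lemma sum_ord4 (V : nmodType) (F : 'I_4 -> V) : \sum_i F i = F 0 + F 1 + F 2 + F 3.
Proof.
rewrite !big_ord_recl big_ord0 addr0 !addrA.
by congr (F _ + F _ + F _ + F _); apply: val_inj.
Qed.

Section MixedDiscriminant.
Variable R : realFieldType.
Implicit Types (x y : 'I_4 -> R) (B : 'I_4 -> 'I_4 -> R).

(* [x] encodes the Hermitian matrix with diagonal [x 0], [x 1] and upper
   off-diagonal entry [x 2 + i x 3]; [mixed x x] is twice its determinant. *)
Definition mixed x y : R := x 0 * y 1 + y 0 * x 1 - 2 * (x 2 * y 2 + x 3 * y 3).

(** Sylvester's criterion: a positive corner entry and a positive determinant. *)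
Definition posdef x : Prop := 0 < x 0 /\ 0 < mixed x x.

Lemma mixedC x y : mixed x y = mixed y x.
Proof. by rewrite /mixed; ring. Qed.

(** [x0 y0 mixed x y] equals [(y0^2 mixed x x + x0^2 mixed y y) / 2] plus the squares of
    [x0 y2 - y0 x2] and [x0 y3 - y0 x3]. *)
Lemma mixed_gt0 x y : posdef x -> posdef y -> 0 < mixed x y.
Proof.
rewrite /posdef /mixed => -[x0 xx] [y0 yy].
have x0y0 : 0 < x 0 * y 0 by apply: mulr_gt0.
rewrite -(pmulr_rgt0 _ x0y0).
have hx := mulr_gt0 (mulr_gt0 y0 y0) xx.
have hy := mulr_gt0 (mulr_gt0 x0 x0) yy.
have h2 := sqr_ge0 (x 0 * y 2 - y 0 * x 2).
have h3 := sqr_ge0 (x 0 * y 3 - y 0 * x 3).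
nra.
Qed.

Lemma mixed_suml x B y :
  mixed (fun k => \sum_j x j * B j k) y = \sum_j x j * mixed (B j) y.
Proof. by rewrite /mixed !big_ord_recl !big_ord0; ring. Qed.

(** A timelike [x] has [x 0 != 0]; if [x 0 < 0], then [- x] is positive definite and [mixed x y]
    would be negative. *)
Lemma posdef_of_mixed_gt0 x y : posdef y -> 0 < mixed x x -> 0 < mixed x y -> posdef x.
Proof.
move=> py xx xy; split=> //; have [x0|//|x0] := ltgtP (x 0) 0; last first.
  move: xx; rewrite /mixed x0 !mul0r; have := sqr_ge0 (x 2); have := sqr_ge0 (x 3).
  by rewrite !expr2; lra.
have px : posdef (fun k => - x k).
  by split; [rewrite oppr_gt0|move: xx; rewrite /mixed; lra].
by have := mixed_gt0 px py; move: xy; rewrite /mixed; lra.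
Qed.

(* For [x] in the kernel, [v = sum_j x_j B_j] satisfies
   [mixed v (B i) = x i * mixed (B i) (B i)], hence [mixed v v > 0]: [v] is
   definite, so all [x i] are positive, and row [0] cannot vanish. *)
Lemma mixed_offdiag_kernel B x :
  (forall i, posdef (B i)) -> 0 < x 0 ->
  ~ (forall i, \sum_(j | j != i) x j * mixed (B j) (B i) = 0).
Proof.
move=> pB x0 ker; pose v k := \sum_j x j * B j k.
have vB i : mixed v (B i) = x i * mixed (B i) (B i).
  by rewrite mixed_suml (bigD1 i) //= ker addr0.
have BB i : 0 < mixed (B i) (B i) by case: (pB i).
have vv : 0 < mixed v v.
  rewrite {1}/v mixed_suml (bigD1 0) //= mixedC vB ltr_wpDr //.
    by apply: sumr_ge0 => i _; rewrite mixedC vB mulrA mulr_ge0 -?expr2 ?sqr_ge0 ?(ltW (BB i)).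
  by rewrite mulr_gt0 // mulr_gt0.
have pv : posdef v by apply: (@posdef_of_mixed_gt0 v (B 0)); rewrite ?vB ?mulr_gt0.
have xi i : 0 < x i by have := mixed_gt0 pv (pB i); rewrite vB pmulr_lgt0.
have := ker 0; apply/eqP; rewrite gt_eqF // (bigD1 1) //= ltr_wpDr //.
  by apply: sumr_ge0 => j _; rewrite mulr_ge0 ?ltW // mixed_gt0.
by rewrite mulr_gt0 // mixed_gt0.
Qed.
End MixedDiscriminant.

(* The determinant of a symmetric 4 x 4 matrix [q] with zero diagonal, with
   [a = q01 q23], [b = q02 q13], [c = q03 q12]. *)
Definition det_hollow (K : pzRingType) (a b c : K) : K :=
  a ^+ 2 + b ^+ 2 + c ^+ 2 - 2 * (a * b + b * c + c * a).

Lemma rmorph_det_hollow (K L : pzRingType) (f : {rmorphism K -> L}) a b c :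
  f (det_hollow a b c) = det_hollow (f a) (f b) (f c).
Proof.
by rewrite /det_hollow rmorphB [f (2 * _)]rmorphM rmorph_nat 4!rmorphD !rmorphXn !rmorphM.
Qed.

(** Cramer's rule for the first unknown; the other unknowns are reached by relabelling the
    indices. *)
Lemma hollow_kernel (K : idomainType) (q01 q02 q03 q12 q13 q23 y0 y1 y2 y3 : K) :
  det_hollow (q01 * q23) (q02 * q13) (q03 * q12) != 0 ->
  q01 * y1 + q02 * y2 + q03 * y3 = 0 -> q01 * y0 + q12 * y2 + q13 * y3 = 0 ->
  q02 * y0 + q12 * y1 + q23 * y3 = 0 -> q03 * y0 + q13 * y1 + q23 * y2 = 0 ->
  y0 = 0.
Proof.
set a := q01 * q23; set b := q02 * q13; set c := q03 * q12 => det0 e0 e1 e2 e3.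
apply/eqP; rewrite -(mulrI_eq0 _ (mulfI det0)); apply/eqP.
(* The multipliers of the four equations form the first row of the adjugate. *)
transitivity (2 * q12 * q13 * q23 * (q01 * y1 + q02 * y2 + q03 * y3)
  + (a - b - c) * q23 * (q01 * y0 + q12 * y2 + q13 * y3)
  + (b - a - c) * q13 * (q02 * y0 + q12 * y1 + q23 * y3)
  + (c - a - b) * q12 * (q03 * y0 + q13 * y1 + q23 * y2)).
  by rewrite /det_hollow /a /b /c; ring.
by rewrite e0 e1 e2 e3 !mulr0 !addr0.
Qed.

(** Were the determinant zero, a column of the adjugate would be a kernel vector of the off-diagonal
    Gram matrix; its first entry is a product of positive numbers, against
    [mixed_offdiag_kernel]. *)
Lemma det_hollow_mixed (R : realFieldType) (B : 'I_4 -> 'I_4 -> R) :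
  (forall i, posdef (B i)) ->
  det_hollow (mixed (B 0) (B 1) * mixed (B 2) (B 3))
    (mixed (B 0) (B 2) * mixed (B 1) (B 3)) (mixed (B 0) (B 3) * mixed (B 1) (B 2)) != 0.
Proof.
move=> pB; apply/eqP => det0.
pose D i j := mixed (B i) (B j).
have DC i j : D i j = D j i by apply: mixedC.
pose a := D 0 1 * D 2 3; pose b := D 0 2 * D 1 3; pose c := D 0 3 * D 1 2.
have {}det0 : det_hollow a b c = 0 by [].
(* the first column of the adjugate *)
pose x := fun i : 'I_4 => [:: 2 * D 1 2 * D 1 3 * D 2 3; (a - b - c) * D 2 3;
  (b - a - c) * D 1 3; (c - a - b) * D 1 2]`_i.
apply: (@mixed_offdiag_kernel _ B x) => //.
  by rewrite /x /= !mulr_gt0 ?mixed_gt0 ?ltr0n.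
have x_ker i : \sum_(j < 4 | j != i) x j * D j i = 0.
  rewrite big_mkcond sum_ord4; have [] := ord4_cases i => ->.
  - rewrite (DC 1 0) (DC 2 0) (DC 3 0) /x /= add0r -det0 /det_hollow /a /b /c; ring.
  - rewrite (DC 2 1) (DC 3 1) /x /= /a /b /c; ring.
  - rewrite (DC 3 2) /x /= /a /b /c; ring.
  - rewrite /x /= /a /b /c; ring.
exact: x_ker.
Qed.

(** * Forms diagonal in the coordinates *)

Section PairForms.
Variables (R : realType) (n : nat).
Local Notation form := (ccform R n).
Local Notation C := (Cx R).
Local Notation idx := 'I_(n + n).
Implicit Types (a b c : form) (S T U : {set idx}) (K : {set 'I_n}).
Local Notation e := (@basis_form R n).

Definition coord_idx (s : idx) : 'I_n := match split s with inl k => k | inr k => k end.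

Lemma coord_lshift k : coord_idx (lshift n k) = k.
Proof. by rewrite /coord_idx (unsplitK (inl k)). Qed.

Lemma coord_rshift k : coord_idx (rshift n k) = k.
Proof. by rewrite /coord_idx (unsplitK (inr k)). Qed.

Definition pairs K : {set idx} := coord_idx @^-1: K.

Lemma pairs_lshift K k : (lshift n k \in pairs K) = (k \in K).
Proof. by rewrite inE coord_lshift. Qed.

Lemma pairs_rshift K k : (rshift n k \in pairs K) = (k \in K).
Proof. by rewrite inE coord_rshift. Qed.

Lemma pairs1 l : pairs [set l] = [set lshift n l] :|: [set rshift n l].
Proof.
apply/setP => s; case: (split_ordP s) => k ->.
  by rewrite pairs_lshift !inE eq_lrshift orbF (inj_eq (@lshift_inj _ _)).
by rewrite pairs_rshift !inE eq_rlshift (inj_eq (@rshift_inj _ _)).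
Qed.

(** The comparison of [m] with [l] occurs twice and cancels; what remains is the one inversion of
    [dzbar_l] with [dz_m]. *)
Lemma wsign_pairs1 l m : wsign R (pairs [set l]) (pairs [set m]) = -1.
Proof.
have disj k : [disjoint [set lshift n k] & [set rshift n k]].
  by rewrite disjoints1 inE eq_lrshift.
rewrite !pairs1 (wsignUl _ _ (disj l)) !(wsignUr _ _ (disj m)) !wsign11 /=.
rewrite ltn_add2l [(n + m < l)%N]ltnNge (leq_trans (ltnW (ltn_ord l)) (leq_addr _ _)).
rewrite (leq_trans (ltn_ord m) (leq_addr _ _)) expr0 expr1 mulr1 mulN1r mulrN.
by rewrite -expr2 sqrr_sign.
Qed.

Lemma wsign_pairs2 i l m : l != m ->
  wsign R (pairs [set i]) (pairs [set l; m]) = 1.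
Proof.
move=> lm; have -> : pairs [set l; m] = pairs [set l] :|: pairs [set m].
  by rewrite /pairs preimsetU.
rewrite wsignUr ?wsign_pairs1 ?mulrNN ?mulr1 //.
rewrite -setI_eq0 -preimsetI; apply/eqP/setP => s; rewrite !inE.
by apply/negbTE; apply: contra lm => /andP[/eqP<-].
Qed.

Lemma wedge_dz_dzb k l : wedge (@dz R n k) (@dzb R n l) = e [set lshift n k; rshift n l].
Proof.
rewrite wedge_basis_disjoint ?wsign11.
  by rewrite /= ltnNge (leq_trans (ltnW (ltn_ord k)) (leq_addr _ _)) scale1r.
by apply/eqP; rewrite setI_eq0 disjoints1 inE eq_lrshift.
Qed.

Definition std_pair (l : 'I_n) : form := (imC R / 2) *: e (pairs [set l]).

Lemma pullback_std_pair A l : pullback A (std_pair l) = std11 A l.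
Proof.
rewrite /std_pair pairs1 -wedge_dz_dzb linearZ /= pullback_wedge.
by rewrite pullback_dz pullback_dzb.
Qed.

Lemma sqr_imC : imC R ^+ 2 = -1.
Proof. exact: sqr_i. Qed.

(** The factor [4^-1] is [(i/2)^2] times the reordering sign [-1]. *)
Lemma wedge_std_pair l m : wedge (std_pair l) (std_pair m) =
  (if l == m then 0 else 4^-1) *: e (pairs [set l; m]).
Proof.
rewrite wedgeZl wedgeZr; case: eqVneq => [<-|lm].
  rewrite wedge_basis_meet ?scaler0 ?scale0r //.
  by apply/set0Pn; exists (lshift n l); rewrite setIid pairs_lshift inE.
rewrite wedge_basis_disjoint ?wsign_pairs1; last first.
  rewrite -preimsetI; apply/setP => s; rewrite !inE.
  by apply/negbTE; apply: contra lm => /andP[/eqP<-].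
rewrite -preimsetU !scalerA mulrN1; congr (_ *: _).
rewrite mulrACA -expr2 sqr_imC mulN1r opprK -invfM; congr (_^-1).
by rewrite -natrM.
Qed.

(** Only the monomial indexed by [U :\: T] is completed to [U] by [T]. *)
Lemma wedge_basisr_coef a T U : wedge a (e T) U =
  if T \subset U then wsign R (U :\: T) T * a (U :\: T) else 0.
Proof.
rewrite ffunE; under eq_bigr => S _.
  rewrite (bigD1 T) //= big1 ?addr0 ?ffunE ?eqxx ?mulr1; last first.
    by move=> T' TT'; rewrite ffunE (negbTE TT') mulr0; case: ifP.
  over.
case: ifPn => TU.
  rewrite (bigD1 (U :\: T)) //= big1 ?addr0.
    have -> : (U :\: T) :&: T = set0 by rewrite setDE -setIA [~: T :&: T]setIC setICr setI0.
    have -> : U :\: T :|: T = U.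
      by apply/setP => s; rewrite !inE; case: (boolP (s \in T)) => [/(subsetP TU)->|_];
        rewrite ?orbF.
    by rewrite !eqxx.
  move=> S SUT; case: ifP => // /andP[/eqP ST /eqP SU]; case/negP: SUT.
  by rewrite -SU setDUl setDv setU0 eq_sym; apply/eqP/setDidPl; rewrite -setI_eq0 ST.
apply: big1 => S _; case: ifP => // /andP[_ /eqP SU].
by rewrite -SU subsetUr in TU.
Qed.

(** [c] need not be symmetric: since the [w_l] commute, the product [w_l w_m] with [l != m] has
    total coefficient [c l m + c m l]. *)
Definition pair_form (c : 'I_n -> 'I_n -> C) : form :=
  \sum_l \sum_m c l m *: wedge (std_pair l) (std_pair m).

Lemma wedge_lincomb (u v : 'I_n -> C) (x y : 'I_n -> form) :
  wedge (\sum_l u l *: x l) (\sum_m v m *: y m) =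
  \sum_l \sum_m (u l * v m) *: wedge (x l) (y m).
Proof.
rewrite wedge_suml; apply: eq_bigr => l _.
rewrite wedgeZl wedge_sumr scaler_sumr; apply: eq_bigr => m _.
by rewrite wedgeZr scalerA.
Qed.

Lemma pullback_pair_form A (c : 'I_n -> 'I_n -> C) : pullback A (pair_form c) =
  \sum_l \sum_m c l m *: wedge (std11 A l) (std11 A m).
Proof.
rewrite /pair_form linear_sum; apply: eq_bigr => l _; rewrite linear_sum.
apply: eq_bigr => m _.
by rewrite linearZ /= pullback_wedge !pullback_std_pair.
Qed.

Lemma wedge_pair_form_coef a (c : 'I_n -> 'I_n -> C) U :
  wedge a (pair_form c) U = 4^-1 * \sum_l \sum_m
    if (l != m) && (pairs [set l; m] \subset U)
    then c l m * (wsign R (U :\: pairs [set l; m]) (pairs [set l; m])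
                  * a (U :\: pairs [set l; m])) else 0.
Proof.
rewrite wedge_sumr sum_ffunE mulr_sumr; apply: eq_bigr => l _.
rewrite wedge_sumr sum_ffunE mulr_sumr; apply: eq_bigr => m _.
rewrite wedge_std_pair !wedgeZr !formZE wedge_basisr_coef.
by case: eqVneq => _ /=; [|case: ifP => _]; rewrite ?mul0r ?mulr0 // mulrCA.
Qed.
End PairForms.

(** * Injectivity of the product with a diagonal form in dimension four *)

Lemma uniq4P (T : eqType) (i j k l : T) : uniq [:: i; j; k; l] ->
  [/\ i != j, i != k & i != l] /\ [/\ j != k, j != l & k != l].
Proof.
by rewrite /= !inE !negb_or => /and4P[/and3P[-> -> ->] /andP[-> ->] -> _].
Qed.

(** Four distinct indices exhaust ['I_4], so one computation serves every labelling of the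
    coordinates. *)
Lemma sum_ord4_uniq (V : nmodType) (i j k l : 'I_4) (F : 'I_4 -> V) :
  uniq [:: i; j; k; l] -> \sum_x F x = F i + F j + F k + F l.
Proof.
move=> u; have full : [:: i; j; k; l] =i predT.
  have /uniq_min_size : {subset [:: i; j; k; l] <= enum 'I_4} by move=> x; rewrite mem_enum.
  by case=> //; rewrite ?size_enum_ord // => _ eq x; rewrite eq mem_enum.
have <- : \sum_(x <- [:: i; j; k; l]) F x = \sum_x F x.
  by rewrite big_uniq //; apply: eq_bigl => x; rewrite full.
by rewrite !big_cons big_nil addr0 !addrA.
Qed.

Lemma setC3_ord4 (i j k l : 'I_4) : uniq [:: i; j; k; l] ->
  ~: [set i] :\: [set j; k] = [set l].
Proof.
move=> /uniq4P[[ij ik il] [jk jl kl]]; apply/eqP; rewrite eq_sym eqEcard sub1set !inE cards1.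
rewrite [l == i]eq_sym [l == j]eq_sym [l == k]eq_sym.
rewrite (negbTE il) (negbTE jl) (negbTE kl) /=.
have -> : ~: [set i] :\: [set j; k] = ~: (i |: [set j; k]).
  by rewrite setCU setDE.
by rewrite -(leq_add2l #|i |: [set j; k]|) cardsC card_ord cardsU1 cards2 !inE negb_or ij ik jk.
Qed.

Section PairFormInjective.
Variable R : realType.
Local Notation form := (ccform R 4).
Local Notation C := (Cx R).
Local Notation idx := 'I_(4 + 4).
Variables (c : 'I_4 -> 'I_4 -> C) (a : form).
Local Notation D l m := (c l m + c m l).
Hypothesis aOm : wedge a (pair_form c) = 0.

Let aOm_coef (U : {set idx}) : \sum_l \sum_m
    (if (l != m) && (pairs [set l; m] \subset U)
     then c l m * (wsign R (U :\: pairs [set l; m]) (pairs [set l; m])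
                  * a (U :\: pairs [set l; m])) else 0) = 0.
Proof.
have /ffunP/(_ U) := aOm; rewrite wedge_pair_form_coef [RHS]ffunE => /eqP.
by rewrite mulf_eq0 invr_eq0 pnatr_eq0 => /eqP.
Qed.

(** With [q], [r] the two coordinates missed by [s] and [t], the coefficient of the product at [U]
    is, up to a nonzero constant, [D q r * a [set s; t]]. *)
Lemma wedge_pair_form_offdiag s t :
  (forall l m, l != m -> D l m != 0) ->
  coord_idx s != coord_idx t -> a [set s; t] = 0.
Proof.
move=> D0 st; pose K := ~: [set coord_idx s; coord_idx t].
have /cards2P[q [r [qr Kqr]]] : #|K| == 2.
  by rewrite -(eqn_add2l #|[set coord_idx s; coord_idx t]|) cardsC card_ord cards2 st.
pose S := [set s; t]; pose U := S :|: pairs K.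
have SK : [disjoint S & pairs K].
  rewrite -setI_eq0; apply/eqP/setP => u; rewrite !inE.
  by apply/negP => /andP[/orP[]/eqP->]; rewrite eqxx ?orbT.
have US : U :\: pairs K = S.
  by rewrite setDUl setDv setU0; apply/setDidPl.
(* As [s] and [t] lie over different coordinates, they cannot supply both [dz_l] and [dzbar_l]. *)
have inK l : lshift 4 l \in U -> rshift 4 l \in U -> l \in K.
  rewrite !(in_setU _ S) pairs_lshift pairs_rshift; case: (l \in K) => //.
  rewrite !orbF !in_set2 => /orP[]/eqP es /orP[]/eqP et; move: st;
    rewrite -?es -?et ?coord_lshift ?coord_rshift ?eqxx //.
  - by have /eqP := etrans es (esym et); rewrite eq_lrshift.
  - by have /eqP := etrans es (esym et); rewrite eq_lrshift.
have sub_U l m : (pairs [set l; m] \subset U) -> l \in [set q; r] /\ m \in [set q; r].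
  move=> /subsetP lmU; rewrite -Kqr.
  by split; apply: inK; apply: lmU; rewrite ?pairs_lshift ?pairs_rshift !inE eqxx ?orbT.
have qrU : pairs [set q; r] \subset U by rewrite -Kqr subsetUr.
have := aOm_coef U; rewrite pair_big /= (bigD1 (q, r)) //= (bigD1 (r, q)) /=; last first.
  by rewrite xpair_eqE negb_and qr orbT.
rewrite big1 ?addr0 => [|[l m] /= /andP[lm_qr lm_rq]]; last first.
  case: ifP => // /andP[lm /sub_U[]]; rewrite !inE => lq mq; exfalso.
  move: lm lm_qr lm_rq; rewrite !xpair_eqE.
  by case/orP: lq => /eqP->; case/orP: mq => /eqP->; rewrite ?eqxx.
rewrite [[set r; q]]setUC qrU qr [r == q]eq_sym qr /= -Kqr US -mulrDl => /eqP.
(* Besides [a S] only a product of powers of [-1] is left, and it is nonzero. *)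
rewrite !mulf_eq0 (negbTE (D0 _ _ qr)) wsignE /= => /orP[|/eqP//].
by rewrite prodf_seq_eq0 => /hasP[u _ /andP[_]]; rewrite prodf_seq_eq0 => /hasP[v _];
  rewrite signr_eq0 andbF.
Qed.

(** This is the coefficient at the pairs over [i], [j], [k]: one of the three comes from [a], the
    other two from the pair form, with sign 1. *)
Lemma wedge_pair_form_diag i j k l : uniq [:: i; j; k; l] ->
  D i j * a (pairs [set k]) + D i k * a (pairs [set j]) + D j k * a (pairs [set i]) = 0.
Proof.
move=> u; pose U := @pairs 4 (~: [set l]).
have UE x y z : uniq [:: l; x; y; z] -> U :\: pairs [set x; y] = pairs [set z].
  by move=> u'; rewrite /U /pairs -preimsetD (setC3_ord4 u').
have lU x y : (pairs [set x; y] \subset U) = (x != l) && (y != l).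
  apply/subsetP/andP => [xyU|[xl yl] s].
    by have [] := (xyU (lshift 4 x), xyU (lshift 4 y));
      rewrite /U !pairs_lshift !inE !eqxx orbT => -> // ->.
  by rewrite !inE => /orP[]/eqP->.
have := aOm_coef U; rewrite (sum_ord4_uniq _ u).
have [[ij ik il] [jk jl kl]] := uniq4P u.
have [ji ki li] : [/\ j != i, k != i & l != i].
  by rewrite [j == i]eq_sym [k == i]eq_sym [l == i]eq_sym.
have [kj lj lk] : [/\ k != j, l != j & l != k].
  by rewrite [k == j]eq_sym [l == j]eq_sym [l == k]eq_sym.
rewrite !(sum_ord4_uniq _ u).
rewrite !lU !eqxx ?ij ?ik ?il ?jk ?jl ?kl ?ji ?ki ?li ?kj ?lj ?lk /= ?andbF /=.
have E x y z : uniq [:: l; x; y; z] ->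
   wsign R (U :\: pairs [set x; y]) (pairs [set x; y]) * a (U :\: pairs [set x; y])
   = a (pairs [set z]).
  move=> u'; rewrite (UE _ _ _ u') wsign_pairs2 ?mul1r //.
  by have [_ []] := uniq4P u'.
rewrite (E i j k) ?(E i k j) ?(E j k i) ?(E j i k) ?(E k i j) ?(E k j i);
  rewrite /= ?inE ?negb_or ?ij ?ik ?il ?jk ?jl ?kl ?ji ?ki ?li ?kj ?lj ?lk //.
by rewrite !addr0 !add0r => e; rewrite -[RHS]e; ring.
Qed.

(** A two-element index set either meets two coordinates, where [wedge_pair_form_offdiag] applies,
    or is one pair; the four pair coefficients solve a hollow linear system. *)
Lemma wedge_pair_form_inj :
  (forall l m, l != m -> D l m != 0) ->
  det_hollow (D 0 1 * D 2 3) (D 0 2 * D 1 3) (D 0 3 * D 1 2) != 0 ->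
  (forall S : {set idx}, a S != 0 -> #|S| = 2%N) -> a = 0.
Proof.
move=> D0 det0 a2; apply/ffunP => S; rewrite [RHS]ffunE.
have [->//|aS] := eqVneq (a S) 0; have /eqP/cards2P[s [t [st ES]]] := a2 _ aS.
have [st'|/(wedge_pair_form_offdiag D0)] := eqVneq (coord_idx s) (coord_idx t); last first.
  by rewrite -ES.
have {st st' ES} -> : S = pairs [set coord_idx s].
  rewrite ES pairs1 /coord_idx; move: st st'.
  case: (split_ordP s) => k ->; case: (split_ordP t) => l ->;
    rewrite ?coord_lshift ?coord_rshift => + kl; rewrite kl ?eqxx // => _;
    rewrite ?(unsplitK (inl l)) ?(unsplitK (inr l)) //.
  by rewrite setUC.
(* The row omitting coordinate 0: the entry in column [l] is the [D] of the two remaining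
   coordinates. The next three rows omit 1, 2 and 3. *)
have e0 : D 2 3 * a (pairs [set 1]) + D 1 3 * a (pairs [set 2]) + D 1 2 * a (pairs [set 3]) = 0.
  by rewrite -[RHS](@wedge_pair_form_diag 1 2 3 0) //; ring.
have e1 : D 2 3 * a (pairs [set 0]) + D 0 3 * a (pairs [set 2]) + D 0 2 * a (pairs [set 3]) = 0.
  by rewrite -[RHS](@wedge_pair_form_diag 0 2 3 1) //; ring.
have e2 : D 1 3 * a (pairs [set 0]) + D 0 3 * a (pairs [set 1]) + D 0 1 * a (pairs [set 3]) = 0.
  by rewrite -[RHS](@wedge_pair_form_diag 0 1 3 2) //; ring.
have e3 : D 1 2 * a (pairs [set 0]) + D 0 2 * a (pairs [set 1]) + D 0 1 * a (pairs [set 2]) = 0.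
  by rewrite -[RHS](@wedge_pair_form_diag 0 1 2 3) //; ring.
case: (ord4_cases (coord_idx s)) => ->.
(* Each case lists the wanted unknown first; this only permutes the three products in [det_hollow],
   which is symmetric in them. *)
- apply: (@hollow_kernel _ (D 2 3) (D 1 3) (D 1 2) (D 0 3) (D 0 2) (D 0 1)
    (a (pairs [set 0])) (a (pairs [set 1])) (a (pairs [set 2])) (a (pairs [set 3]))).
    by move: det0; rewrite /det_hollow; congr (_ != 0); ring.
    by rewrite -[RHS]e0; ring.
    by rewrite -[RHS]e1; ring.
    by rewrite -[RHS]e2; ring.
  by rewrite -[RHS]e3; ring.
- apply: (@hollow_kernel _ (D 2 3) (D 0 3) (D 0 2) (D 1 3) (D 1 2) (D 0 1)
    (a (pairs [set 1])) (a (pairs [set 0])) (a (pairs [set 2])) (a (pairs [set 3]))).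
    by move: det0; rewrite /det_hollow; congr (_ != 0); ring.
    by rewrite -[RHS]e1; ring.
    by rewrite -[RHS]e0; ring.
    by rewrite -[RHS]e2; ring.
  by rewrite -[RHS]e3; ring.
- apply: (@hollow_kernel _ (D 1 3) (D 0 3) (D 0 1) (D 2 3) (D 1 2) (D 0 2)
    (a (pairs [set 2])) (a (pairs [set 0])) (a (pairs [set 1])) (a (pairs [set 3]))).
    by move: det0; rewrite /det_hollow; congr (_ != 0); ring.
    by rewrite -[RHS]e2; ring.
    by rewrite -[RHS]e0; ring.
    by rewrite -[RHS]e1; ring.
  by rewrite -[RHS]e3; ring.
- apply: (@hollow_kernel _ (D 1 2) (D 0 2) (D 0 1) (D 2 3) (D 1 3) (D 0 3)
    (a (pairs [set 3])) (a (pairs [set 0])) (a (pairs [set 1])) (a (pairs [set 2]))).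
    by move: det0; rewrite /det_hollow; congr (_ != 0); ring.
    by rewrite -[RHS]e3; ring.
    by rewrite -[RHS]e0; ring.
    by rewrite -[RHS]e1; ring.
  by rewrite -[RHS]e2; ring.
Qed.
End PairFormInjective.

(** * Positivity of the coefficients *)

Section Positivity.
Variable R : realType.
Local Notation C := (Cx R).

Lemma std11_pairs_coef n (G : 'M[C]_n) m l :
  std11 G m (pairs [set l]) = (imC R / 2) * (G m l * conjc (G m l)).
Proof.
rewrite /std11 formZE; congr (_ * _).
rewrite /dw /dwb wedge_suml sum_ffunE (bigD1 l) //= [X in _ + X]big1 ?addr0 => [|k kl].
  rewrite wedgeZl formZE wedge_sumr sum_ffunE (bigD1 l) //= big1 ?addr0 => [|k kl].
    by rewrite wedgeZr formZE wedge_dz_dzb pairs1 ffunE eqxx mulr1.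
  rewrite wedgeZr formZE wedge_dz_dzb ffunE; case: eqP => [/setP/(_ (rshift n k))|].
    by rewrite pairs_rshift !inE eqxx orbT (negbTE kl).
  by rewrite mulr0.
rewrite wedgeZl formZE wedge_sumr sum_ffunE big1 ?mulr0 // => k' _.
rewrite wedgeZr formZE wedge_dz_dzb ffunE; case: eqP => [/setP/(_ (lshift n k))|].
  by rewrite pairs_lshift !inE eqxx (negbTE kl).
by rewrite mulr0.
Qed.

(** In the coordinates given by [A], comparing coefficients of [dz_l dzbar_l] gives [c l] as the sum
    of the squared moduli of column [l] of [G = A' A^-1]. *)
Lemma kahler_diag_gt0 n (A : 'M[C]_n) (c : 'I_n -> C) :
  A \in unitmx -> kahler (\sum_l c l *: std11 A l) -> forall l, 0 < c l.
Proof.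
move=> uA [A' [uA' eA]] l.
pose G := A' *m invmx A.
have uG : G \in unitmx by rewrite unitmx_mul uA' unitmx_inv.
have eG : \sum_m c m *: std_pair R m = \sum_m std11 G m.
  move/(congr1 (pullback (invmx A))): eA; rewrite !linear_sum /= => eA.
  rewrite -[RHS](_ : \sum_m pullback (invmx A) (std11 A' m) = _); last first.
    apply: eq_bigr => m _.
    by rewrite /std11 linearZ /= pullback_wedge pullback_dw pullback_dwb.
  rewrite -eA; apply: eq_bigr => m _; rewrite [RHS]linearZ /=; congr (_ *: _).
  by rewrite -[std11 A m]pullback_std_pair pullbackK // mulmxV.
have /ffunP/(_ (pairs [set l])) := eG.
rewrite !sum_ffunE (bigD1 l) //= big1 ?addr0 => [|m ml]; last first.
  rewrite formZE /std_pair formZE ffunE; case: eqP => [/setP/(_ (lshift n m))|].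
    by rewrite !pairs_lshift !inE eqxx (negbTE ml).
  by rewrite !mulr0.
under eq_bigr do rewrite std11_pairs_coef.
rewrite formZE /std_pair formZE ffunE eqxx mulr1 -mulr_sumr mulrC => /mulfI ->.
  rewrite lt_def sumr_ge0 ?andbT => [|m _]; last exact: mulcJ_ge0.
  rewrite psumr_neq0 => [|m _]; last exact: mulcJ_ge0.
  (* A zero column would contradict the invertibility of [G]. *)
  have [m Gml] : exists m, G m l != 0.
    apply/existsP; apply: contraT; rewrite negb_exists => /forallP G0.
    have /matrixP/(_ l l) := mulVmx uG.
    rewrite !mxE eqxx big1 => [/eqP|m _]; first by rewrite eq_sym oner_eq0.
    by have := G0 m; rewrite negbK => /eqP->; rewrite mulr0.
  apply/hasP; exists m; rewrite ?mem_index_enum //=.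
  by rewrite lt_def mulf_neq0 ?conjc_eq0 //= mulcJ_ge0.
rewrite mulf_neq0 ?invr_eq0 ?pnatr_eq0 //.
by rewrite /imC eq_complex /= oner_eq0 andbF.
Qed.

(** Evaluation at well-chosen vectors [theta] yields first the Hermitian symmetry, then Sylvester's
    two inequalities. *)
Lemma posdef_of_form (b : 'I_2 -> 'I_2 -> C) :
  (forall theta : 'I_2 -> C, (exists i, theta i != 0) ->
     0 < \sum_i \sum_j theta i * conjc (theta j) * b i j) ->
  exists x : 'I_4 -> R, [/\ posdef x, b 0 0 = (x 0)%:C%C, b 1 1 = (x 1)%:C%C,
    b 0 1 = (x 2 +i* x 3)%C & b 1 0 = (x 2 -i* x 3)%C].
Proof.
have sum2 (F : 'I_2 -> C) : \sum_i F i = F 0 + F 1.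
  by rewrite !big_ord_recl big_ord0 addr0; congr (F _ + F _); apply: val_inj.
move=> bpos.
have {}bpos t0 t1 : (t0 != 0) || (t1 != 0) -> 0 < t0 * conjc t0 * b 0 0
    + t0 * conjc t1 * b 0 1 + (t1 * conjc t0 * b 1 0 + t1 * conjc t1 * b 1 1).
  move=> t; have := bpos (fun i => if i == 0 then t0 else t1).
  rewrite !sum2 /=; apply; case/orP: t => t; first by exists 0.
  by exists 1.
case E00 : (b 0 0) bpos => [a a']; case E11 : (b 1 1) => [d d'].
case E01 : (b 0 1) => [u v]; case E10 : (b 1 0) => [u' v'] bpos.
have I10 : (1 : C) = (1 +i* 0)%C by [].
(* A positive complex number is real: the vanishing imaginary parts at [(1,0)], [(0,1)], [(1,1)] and
   [(1,i)] make [b] Hermitian. *)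
have := bpos 1 0; rewrite oner_eq0 => /(_ isT).
rewrite ltcE /= => /andP[/eqP h1 h2].
have := bpos 0 1; rewrite oner_eq0 orbT => /(_ isT).
rewrite ltcE /= => /andP[/eqP h3 h4].
have := bpos 1 1; rewrite oner_eq0 => /(_ isT).
rewrite ltcE /= => /andP[/eqP h5 _].
have := bpos 1 'i%C; rewrite oner_eq0 => /(_ isT).
rewrite ltcE /= => /andP[/eqP h7 _].
have a'0 : a' = 0 by lra.
have d'0 : d' = 0 by lra.
have v'E : v' = - v by lra.
have u'E : u' = u by lra.
have d0 : 0 < d by lra.
(* At this vector, a column of the adjugate, the form takes the value [d] times the determinant. *)
have := bpos (d +i* 0)%C (- u -i* v)%C.
rewrite eq_complex /= (gt_eqF d0) /= => /(_ isT).
rewrite ltcE /= => /andP[_ h9].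
exists (fun k : 'I_4 => [:: a; d; u; v]`_k).
split; rewrite ?E00 ?a'0 ?d'0 ?v'E ?u'E //=.
split=> /=; first by lra.
rewrite /mixed /= -(pmulr_rgt0 _ d0).
by move: h9; rewrite a'0 d'0 v'E u'E; lra.
Qed.
End Positivity.

(** * The determinant of a Griffiths positive matrix with diagonalized entries *)

Theorem mainTheorem12 (R : realType) (M : 'I_2 -> 'I_2 -> ccform R 4) :
  griffiths_positive M -> diagonalized_entries M ->
  [/\ lefschetz_form 2 0 (det_form M),
      lefschetz_form 1 1 (det_form M) &
      lefschetz_form 0 2 (det_form M)].
Proof.
move=> [M11 [_ Mpos]] [A [uA [b Mb]]].
have bpos l : exists x : 'I_4 -> R, [/\ posdef x, b 0 0 l = (x 0)%:C%C,
    b 1 1 l = (x 1)%:C%C, b 0 1 l = (x 2 +i* x 3)%C & b 1 0 l = (x 2 -i* x 3)%C].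
  (* Each contraction by [theta] is diagonal in the coordinates [A], so its being Kähler makes every
     coefficient positive. *)
  apply: (posdef_of_form (b := fun i j => b i j l)) => theta /Mpos.
  have -> : \sum_i \sum_j (theta i * conjc (theta j)) *: M i j =
      \sum_l (\sum_i \sum_j theta i * conjc (theta j) * b i j l) *: std11 A l.
    under eq_bigr => i _.
      under eq_bigr do rewrite Mb scaler_sumr.
      rewrite exchange_big; over.
    rewrite exchange_big; apply: eq_bigr => m _ /=.
    rewrite scaler_suml; apply: eq_bigr => i _.
    by rewrite scaler_suml; apply: eq_bigr => j _; rewrite scalerA.
  by move/(kahler_diag_gt0 uA)/(_ l).
have [B BP] : exists B : 'I_4 -> 'I_4 -> R, forall l, [/\ posdef (B l), b 0 0 l = (B l 0)%:C%C,
    b 1 1 l = (B l 1)%:C%C, b 0 1 l = (B l 2 +i* B l 3)%C & b 1 0 l = (B l 2 -i* B l 3)%C].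
  have [[x0 h0] [x1 h1]] := (bpos 0, bpos 1); have [[x2 h2] [x3 h3]] := (bpos 2, bpos 3).
  (* A choice over four indices; the default [x0] of [nth] is never reached. *)
  exists (fun l : 'I_4 => nth x0 [:: x0; x1; x2; x3] l) => l.
  by case: (ord4_cases l) => ->.
have pB l : posdef (B l) by case: (BP l).
pose c l m := b 0 0 l * b 1 1 m - b 0 1 l * b 1 0 m.
have cD l m : c l m + c m l = (mixed (B l) (B m))%:C%C.
  rewrite /c; have [_ -> -> -> ->] := BP l; have [_ -> -> -> ->] := BP m.
  apply/eqP; rewrite eq_complex /= /mixed; apply/andP; split; apply/eqP; ring.
have detE : det_form M = pullback A (pair_form c).
  rewrite /det_form !Mb !wedge_lincomb pullback_pair_form -sumrB.
  apply: eq_bigr => l _; rewrite -sumrB; apply: eq_bigr => m _.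
  by rewrite -scalerBl.
have det22 : is_pq 2 2 (det_form M).
  by apply: is_pqB; apply: (@is_pq_wedge _ _ 1 1 1 1).
(* The three bidegrees share the total degree 2, so one injectivity argument covers them. *)
have inj p q a : (p + q = 2)%N -> is_pq p q a -> wedge a (det_form M) = 0 -> a = 0.
  move=> pq; rewrite detE; apply: (wedge_pullback_inj uA) => {}a pa aOm.
  apply: (wedge_pair_form_inj aOm) => [l m _||S /pa[Sp Sq]].
  - by rewrite cD (inj_eq (@complexI R) _ 0) gt_eqF // mixed_gt0.
  - rewrite !cD -!rmorphM -rmorph_det_hollow.
    by rewrite (inj_eq (@complexI R) _ 0) det_hollow_mixed.
  (* [S] splits into its holomorphic and antiholomorphic indices. *)
  transitivity (p + q)%N => //; rewrite -Sp -Sq -cardsUI (_ : _ :&: _ = set0) ?cards0 ?addn0.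
    by apply: eq_card => s; rewrite !inE -andb_orr; case: ltnP; rewrite ?andbT.
  by apply/setP => s; rewrite !inE; case: ltnP; rewrite ?andbF.
by split; apply: (lefschetz_form_of_inj det22) => // a; apply: inj.
Qed.
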